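(* For each integer $p\ge 1$, let $K_p(x,\cdot)$, $x\in\mathbb{R}^p$, be the $\mathrm{N}(x/2,\,3I_p/4)$ distribution, viewed as a Markov transition function on $\mathbb{R}^p$. For each $p$ let there be given arbitrary measurable $V_p:\mathbb{R}^p\to[0,\infty)$, numbers $\lambda_p<1$, $L_p<\infty$, $d_p>2L_p/(1-\lambda_p)$, $\gamma_p<1$ and a probability measure $\nu_p$ on $\mathbb{R}^p$ such that the drift condition $$\int_{\mathbb{R}^p}V_p(x')\,K_p(x,dx')\le \lambda_pV_p(x)+L_p\qquad\text{for all }x\in\mathbb{R}^p$$ and the minorization condition $$K_p(x,\cdot)\ge(1-\gamma_p)\,\nu_p(\cdot)\qquad\text{for all }x\in C_p:=\{x'\in\mathbb{R}^p:V_p(x')\le d_p\}$$ hold, and let $a_p\in(0,1)$. Let $$\hat\rho_{p}=\gamma_p^{a_p}\vee\left\{\left(\frac{1+2L_p+\lambda_pd_p}{1+d_p}\right)^{1-a_p}\bigl[1+2(\lambda_pd_p+L_p)\bigr]^{a_p}\right\},$$ where $a_p$ is chosen so that $\hat\rho_p$ is a well-defined number less than $1$. Then $\hat\rho_p\to1$ at an exponential rate as $p\to\infty$; that is, there exist constants $c<\infty$ and $r\in(0,1)$ such that $0<1-\hat\rho_p\le c\,r^p$ for all $p$.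
   Context: Here $s\vee t=\max\{s,t\}$ and $I_p$ is the $p\times p$ identity matrix. The quantity $\hat\rho_p$ is Rosenthal's upper bound on the total variation geometric convergence rate of the chain, computed from the drift and minorization conditions; $a_p\in(0,1)$ is a free parameter in that bound. *)

(* Defs.v *)
From HB Require Import structures.
From mathcomp Require Import all_boot all_order all_algebra.
From mathcomp Require Import all_classical all_reals all_analysis.
From mathcomp Require Import measurable_realfun ring.
Import Order.TTheory GRing.Theory Num.Theory.
Import numFieldNormedType.Exports.

Set Implicit Arguments.
Unset Strict Implicit.
Unset Printing Implicit Defensive.

Local Open Scope classical_set_scope.
Local Open Scope ring_scope.

(* R^p with the product (= Borel) sigma-algebra *)
Notation Rvec R p := (p.-tuple (measurableTypeR R)).

Section tuple_product_measure.
Context d (T : measurableType d) {R : realType}.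

Definition tcons n (z : T * n.-tuple T) : n.+1.-tuple T :=
  [tuple of z.1 :: z.2].

Definition tuncons n (t : n.+1.-tuple T) : T * n.-tuple T :=
  (thead t, [tuple of behead t]).

Lemma tconsK n : cancel (@tcons n) (@tuncons n).
Proof. by case=> x t; congr pair; exact/val_inj. Qed.

Lemma tunconsK n : cancel (@tuncons n) (@tcons n).
Proof. by move=> t; rewrite [RHS]tuple_eta. Qed.

Lemma measurable_tcons n : measurable_fun setT (@tcons n).
Proof. exact: measurable_cons. Qed.

Lemma measurable_tuncons n : measurable_fun setT (@tuncons n).
Proof.
apply: measurable_fun_pair; last exact: measurable_behead.
exact: measurable_tnth.
Qed.

Section step.
Local Open Scope ereal_scope.
Context n (m : {sigma_finite_measure set T -> \bar R})
  (mu : {sigma_finite_measure set (n.-tuple T) -> \bar R}).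

Definition tuple_productS : set (n.+1.-tuple T) -> \bar R :=
  pushforward (m \x mu) (@tcons n).

Let tuple_productS0 : tuple_productS set0 = 0.
Proof. by rewrite /tuple_productS /pushforward preimage_set0 measure0. Qed.

Let tuple_productS_ge0 A : 0 <= tuple_productS A.
Proof. by rewrite /tuple_productS /pushforward. Qed.

Let tuple_productS_sigma_additive : semi_sigma_additive tuple_productS.
Proof.
have mtc A : measurable A -> measurable (@tcons n @^-1` A).
  by move=> mA; rewrite -[X in measurable X]setTI; exact: measurable_tcons.
move=> F mF tF mUF; rewrite /tuple_productS /pushforward preimage_bigcup.
apply: measure_semi_sigma_additive => [i||]; first exact: mtc.
  apply/trivIsetP => /= i j _ _ ij; rewrite -preimage_setI.
  by move/trivIsetP : tF => /(_ _ _ _ _ ij) ->//; rewrite preimage_set0.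
by rewrite -preimage_bigcup; exact: mtc.
Qed.

HB.instance Definition _ := isMeasure.Build _ _ _ tuple_productS
  tuple_productS0 tuple_productS_ge0 tuple_productS_sigma_additive.

Let tuple_productS_sigma_finite : sigma_finite setT tuple_productS.
Proof.
have /sigma_finiteP[F [TF ndF Foo]] := sigma_finiteT m.
have /sigma_finiteP[G [TG ndG Goo]] := sigma_finiteT mu.
exists (fun i => @tuncons n @^-1` (F i `*` G i)).
  apply/seteqP; split => // t _.
  have : setT (tuncons t).1 by [].
  have : setT (tuncons t).2 by [].
  rewrite {1}TF {1}TG => -[k _ Gk] [l _ Fl]; exists (maxn l k) => //; split.
    by move: Fl; exact/subsetPset/ndF/leq_maxl.
  by move: Gk; exact/subsetPset/ndG/leq_maxr.
move=> i; have [mFi Fi] := Foo i; have [mGi Gi] := Goo i; split.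
  rewrite -[X in measurable X]setTI.
  by apply: measurable_tuncons => //; exact: measurableX.
rewrite /tuple_productS /pushforward (_ : _ @^-1` _ = F i `*` G i).
  by rewrite product_measure1E// lte_mul_pinfty// ge0_fin_numE.
by rewrite -comp_preimage (_ : _ \o _ = id)//; apply/funext => z /=; rewrite tconsK.
Qed.

HB.instance Definition _ := Measure_isSigmaFinite.Build _ _ _ tuple_productS
  tuple_productS_sigma_finite.

End step.

Fixpoint tuple_product (m : {sigma_finite_measure set T -> \bar R}) n :
    {sigma_finite_measure set (n.-tuple T) -> \bar R} :=
  if n is n'.+1 then tuple_productS m (tuple_product m n')
  else \d_([tuple] : 0.-tuple T).

Lemma ge0_integral_tuple_productS (m : {sigma_finite_measure set T -> \bar R}) n
    (f : n.+1.-tuple T -> \bar R) :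
  measurable_fun [set: n.+1.-tuple T] f -> (forall y, 0 <= f y)%E ->
  (\int[tuple_product m n.+1]_y f y =
   \int[m]_t \int[tuple_product m n]_y f (tcons (t, y)))%E.
Proof.
move=> mf f0.
rewrite (ge0_integral_pushforward (@measurable_tcons n))//.
rewrite preimage_setT fubini_tonelli1//; last by move=> z; exact: f0.
by apply: measurableT_comp => //; exact: measurable_tcons.
Qed.

End tuple_product_measure.

Definition lebesgue_tuple {R : realType} n :
    {sigma_finite_measure set (Rvec R n) -> \bar R} :=
  tuple_product (lebesgue_measure :
    {sigma_finite_measure set (measurableTypeR R) -> \bar R}) n.

Section mvnormal.
Context {R : realType} {n : nat}.

(* Density of N(m, S) with respect to Lebesgue measure on R^n; S is meant to be
   symmetric positive definite (invmx is the identity on singular matrices). *)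
Definition mvnormal_pdf (m : Rvec R n) (S : 'M[R]_n) (y : Rvec R n) : R :=
  let v := \row_i (tnth y i - tnth m i) in
  (Num.sqrt ((2 * pi) ^+ n * \det S))^-1
  * expR (- (v *m invmx S *m v^T) 0 0 / 2).

Definition mvnormal (m : Rvec R n) (S : 'M[R]_n) : set (Rvec R n) -> \bar R :=
  fun A => (\int[lebesgue_tuple n]_(y in A) (mvnormal_pdf m S y)%:E)%E.

Lemma mvnormal_pdf_ge0 m S y : 0 <= mvnormal_pdf m S y.
Proof. by rewrite mulr_ge0 ?invr_ge0 ?sqrtr_ge0 ?expR_ge0. Qed.

Lemma measurable_mvnormal_pdf2 S :
  measurable_fun setT (fun z : Rvec R n * Rvec R n => mvnormal_pdf z.1 S z.2).
Proof.
apply: measurable_funM => //; apply: measurableT_comp => //.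
apply: measurable_funM => //; apply: measurableT_comp => //.
under eq_fun do rewrite mxE.
apply: measurable_sum => i; apply: measurable_funM.
  under eq_fun do rewrite mxE.
  apply: measurable_sum => j; under eq_fun do rewrite mxE.
  apply: measurable_funM => //; apply: measurable_funB.
    by apply: (measurableT_comp (measurable_tnth j)).
  by apply: (measurableT_comp (measurable_tnth j)).
under eq_fun do rewrite !mxE.
apply: measurable_funB.
  by apply: (measurableT_comp (measurable_tnth i)).
by apply: (measurableT_comp (measurable_tnth i)).
Qed.

Lemma measurable_mvnormal_pdf m S : measurable_fun setT (mvnormal_pdf m S).
Proof.
exact: (measurableT_comp (measurable_mvnormal_pdf2 S) (pair1_measurable m)).
Qed.

Section measure.
Context (m : Rvec R n) (S : 'M[R]_n).
Local Open Scope ereal_scope.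

Let mvnormal0 : mvnormal m S set0 = 0.
Proof. exact: integral_set0. Qed.

Let mvnormal_ge0 A : 0 <= mvnormal m S A.
Proof.
by apply: integral_ge0 => y _; rewrite lee_fin mvnormal_pdf_ge0.
Qed.

Let mvnormal_sigma_additive : semi_sigma_additive (mvnormal m S).
Proof.
move=> /= F mF tF mUF; rewrite /mvnormal ge0_integral_bigcup//; first last.
- by move=> y _; rewrite lee_fin mvnormal_pdf_ge0.
- apply/measurable_EFinP; apply: measurable_funTS.
  exact: measurable_mvnormal_pdf.
apply: is_cvg_ereal_nneg_natsum_cond => i _ _.
exact: mvnormal_ge0.
Qed.

HB.instance Definition _ := isMeasure.Build _ _ _ (mvnormal m S)
  mvnormal0 mvnormal_ge0 mvnormal_sigma_additive.

End measure.
End mvnormal.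

Section mvnormal_scalar.
Context {R : realType}.
Local Open Scope ereal_scope.

Lemma mvnormal_pdf_scalar n (m y : Rvec R n) (s : R) : (0 < s)%R ->
  (mvnormal_pdf m (s ^+ 2)%:M y =
   \prod_(i < n) normal_pdf (tnth m i) s (tnth y i))%R.
Proof.
move=> s0; have sN0 : s != 0%R by rewrite gt_eqF.
under eq_bigr do rewrite normal_pdfE//.
rewrite big_split/= /mvnormal_pdf; congr (_ * _)%R.
  rewrite prodr_const card_ord /normal_peak exprVn; congr (_^-1)%R.
  rewrite det_scalar -exprMn; elim: n {m y} => [|n IHn].
    by rewrite !expr0 sqrtr1.
  rewrite exprS [RHS]exprS sqrtrM; last by rewrite !mulr_ge0 ?pi_ge0 ?exprn_ge0// ltW.
  by rewrite IHn; congr (Num.sqrt _ * _)%R; rewrite -mulr_natl; ring.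
rewrite /normal_fun -expR_sum; congr expR.
rewrite invmx_scalar mul_mx_scalar -scalemxAl !mxE mulr_sumr -sumrN mulr_suml.
apply: eq_bigr => i _; rewrite !mxE; field.
by [].
Qed.

Lemma measurable_prod_normal_pdf n (m : Rvec R n) (s : R) :
  measurable_fun [set: Rvec R n]
    (fun y => \prod_(i < n) normal_pdf (tnth m i) s (tnth y i))%R.
Proof.
apply: measurable_prod => i _.
apply: measurableT_comp; first exact: measurable_normal_pdf.
exact: measurable_tnth.
Qed.

Lemma integral_prod_normal_pdf n (m : Rvec R n) (s : R) :
  \int[lebesgue_tuple n]_y
    (\prod_(i < n) normal_pdf (tnth m i) s (tnth y i))%:E = 1.
Proof.
elim: n => [|n IHn] in m *.
  under eq_integral do rewrite big_ord0.
  by rewrite integral_cst//= mul1e diracE in_setT.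
rewrite ge0_integral_tuple_productS; first last.
- by move=> y; rewrite lee_fin prodr_ge0// => i _; exact: normal_pdf_ge0.
- by apply/measurable_EFinP; exact: measurable_prod_normal_pdf.
have {}IHn := IHn (tuncons m).2.
rewrite -[RHS](integral_normal_pdf (thead m) s); apply: eq_integral => t _.
rewrite -[RHS]mule1 -[X in _ * X]IHn -ge0_integralZl_EFin//; first last.
- exact: normal_pdf_ge0.
- by apply/measurable_EFinP; exact: measurable_prod_normal_pdf.
- by move=> y _; rewrite lee_fin prodr_ge0// => i _; exact: normal_pdf_ge0.
apply: eq_integral => y _; rewrite -EFinM big_ord_recl/=.
congr (_ * _)%:E; apply: eq_bigr => i _.
by rewrite [m in LHS]tuple_eta !tnthS.
Qed.

Lemma mvnormal_scalar_setT n (m : Rvec R n) (s : R) : (0 < s)%R ->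
  mvnormal m (s ^+ 2)%:M setT = 1.
Proof.
move=> s0; rewrite -(integral_prod_normal_pdf m s); apply: eq_integral => y _.
by rewrite mvnormal_pdf_scalar.
Qed.

End mvnormal_scalar.

Section gauss_kernel.
Context {R : realType} {p : nat}.

Definition gauss_kernel (x : Rvec R p) : {measure set (Rvec R p) -> \bar R} :=
  mvnormal [tuple tnth x i / 2 | i < p] (3 / 4)%:M.

Let gauss_kernel_measurable A : measurable A ->
  measurable_fun setT (gauss_kernel ^~ A).
Proof.
move=> mA.
pose h (x : Rvec R p) : Rvec R p := [tuple tnth x i / 2 | i < p].
have mh : measurable_fun setT h.
  apply/measurable_fun_tnthP => i.
  under [X in measurable_fun _ X]eq_fun do rewrite /= tnth_mktuple.
  by apply: measurable_funM => //; exact: measurable_tnth.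
pose f (z : Rvec R p * Rvec R p) : \bar R :=
  (mvnormal_pdf (h z.1) (3 / 4)%:M z.2 * \1_A z.2)%:E.
rewrite (_ : (fun x => _) = fubini_F (lebesgue_tuple p) f).
  apply: measurable_fun_fubini_tonelli_F; last first.
    by move=> z; rewrite lee_fin mulr_ge0// mvnormal_pdf_ge0.
  apply/measurable_EFinP; apply: measurable_funM.
    pose g (z : Rvec R p * Rvec R p) := (h z.1, z.2).
    have mg : measurable_fun setT g.
      by apply: measurable_fun_pair => //; exact: measurableT_comp.
    exact: (measurableT_comp (measurable_mvnormal_pdf2 (3 / 4)%:M) mg).
  exact: measurableT_comp.
apply/funext => x; rewrite /gauss_kernel/= /mvnormal integral_mkcond.
by apply: eq_integral => y _; rewrite /f epatch_indic/= EFinM.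
Qed.

HB.instance Definition _ := isKernel.Build _ _ _ _ _ gauss_kernel
  gauss_kernel_measurable.

Let gauss_kernel_setT x : gauss_kernel x setT = 1%E.
Proof.
rewrite /gauss_kernel/= -(@sqr_sqrtr _ (3 / 4)) ?divr_ge0//.
by rewrite mvnormal_scalar_setT// sqrtr_gt0 divr_gt0.
Qed.

HB.instance Definition _ := Kernel_isProbability.Build _ _ _ _ _ gauss_kernel
  gauss_kernel_setT.

End gauss_kernel.

Section drift_minorization.
Context d (T : measurableType d) (R : realType).
Local Open Scope ereal_scope.

Definition drift_condition (K : R.-pker T ~> T) (V : T -> R) (lambda L : R) :=
  forall x, \int[K x]_y (V y)%:E <= (lambda * V x + L)%:E.

Definition minorization_condition (K : R.-pker T ~> T) (C : set T) (gamma : R)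
    (nu : probability T R) :=
  forall x, C x -> forall A, measurable A -> (1 - gamma)%:E * nu A <= K x A.

End drift_minorization.

Section rosenthal.
Context {R : realType}.
Implicit Types lambda L d gamma a : R.

(* Rosenthal's upper bound on the total variation geometric convergence rate of
   a chain with drift parameters (lambda, L) and minorization constant gamma on
   the sublevel set {V <= d}; a is the free parameter of the bound. *)
Definition rosenthal_rho lambda L d gamma a : R :=
  Num.max (gamma `^ a)
    (((1 + 2 * L + lambda * d) / (1 + d)) `^ (1 - a)
     * (1 + 2 * (lambda * d + L)) `^ a).

(* For a in ]0, 1[ the real powers in rosenthal_rho are meaningful iff their
   bases are nonnegative; powR sends a negative base to the junk value 1. *)
Definition rosenthal_rho_defined lambda L d gamma : Prop :=
  [/\ 0 <= gamma, 0 <= (1 + 2 * L + lambda * d) / (1 + d)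
    & 0 <= 1 + 2 * (lambda * d + L)].

End rosenthal.

(* Main.v *)
Require Import Defs.
From mathcomp Require Import all_boot all_order all_algebra.
From mathcomp Require Import all_classical all_reals all_analysis.
From mathcomp Require Import measurable_realfun ring lra.
Import Order.TTheory GRing.Theory Num.Theory.
Import numFieldNormedType.Exports.

(** The chain is reversible with respect to the standard normal law [pi] on
    R^p, because [pi(x) k(x, y)] is symmetric in [x] and [y]
    ([gauss_reversible]); hence [pi] is stationary ([gauss_invariant]).

    Integrating the drift inequality against [pi] would give
    [pi(V) <= L / (1 - lambda)], and since [d > 2 L / (1 - lambda)] Markov's
    inequality would then yield [pi(V > d) < 1/2].  As [V] is not known to be
    [pi]-integrable, the same bound is obtained by truncating [V]
    ([stationary_tail]).  So [C = {V <= d}] carries more than half of the mass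
    of [pi].

    In high dimension a set that heavy cannot be small: a ball of radius
    [s sqrt p] around any point has [pi]-measure at most [(s e^(1/2))^p]
    ([mvnormal_small_ball]), which is below 1/2 already for [s = 1/4] and
    [p = 1].  Therefore [C] contains two points with [|x - y|^2 > p / 16]
    ([sublevel_spread]).

    Minorization on [C] forces [K(x, .)] and [K(y, .)] to share the mass
    [1 - gamma], whereas two normal laws whose means are far apart overlap very
    little ([mvnormal_overlap]): [1 - gamma <= exp(- |x - y|^2 / 24)], which is
    at most [exp(- p / 384)].  Finally [rho >= gamma^a >= gamma], whatever the
    second term of the maximum is, because [0 <= gamma < 1] and [a < 1]; so
    [1 - rho <= 1 - gamma].  This holds for
    every [p >= 1] with the constants [c = 1] and [r = exp(- 1 / 384)]. *)

Set Implicit Arguments.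
Unset Strict Implicit.
Unset Printing Implicit Defensive.

Local Open Scope classical_set_scope.
Local Open Scope ring_scope.

(** * Integration against a measure with a density *)

Section density.
Context d (T : measurableType d) (R : realType).
Variables (mu nu : {measure set T -> \bar R}) (g : T -> R).
Hypotheses (mg : measurable_fun setT g) (g0 : forall x, 0 <= g x).
Hypothesis nuE : forall A, measurable A ->
  nu A = (\int[mu]_(x in A) (g x)%:E)%E.
Local Open Scope ereal_scope.
Import HBNNSimple.

Let integral_density_nnsfun (f : {nnsfun T >-> R}) :
  \int[nu]_x (f x)%:E = \int[mu]_x ((f x)%:E * (g x)%:E).
Proof.
under [LHS]eq_integral do rewrite fimfunE -fsumEFin//.
rewrite [LHS]ge0_integral_fsum//; last 2 first.
  - by move=> r; exact/measurable_EFinP/measurableT_comp.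
  - by move=> n x _; rewrite EFinM nnfun_muleindic_ge0.
under [RHS]eq_integral.
  move=> x _; rewrite fimfunE -fsumEFin// ge0_mule_fsuml; last first.
    by move=> r; rewrite EFinM nnfun_muleindic_ge0.
  over.
rewrite [RHS]ge0_integral_fsum//; last 2 first.
  - move=> r; apply: emeasurable_funM; apply/measurable_EFinP => //.
    exact: measurableT_comp.
  - by move=> n x _; rewrite mule_ge0 ?lee_fin// -lee_fin EFinM nnfun_muleindic_ge0.
apply: eq_fsbigr => r _.
have mr : measurable (f @^-1` [set r]) by exact: measurable_sfunP.
have [r0|r0] := leP 0%R r; last first.
  have f0 : f @^-1` [set r] = set0 by exact: preimage_nnfun0.
  rewrite !integral0_eq// => x _; rewrite f0 indic0 ?mulr0 ?mul0e//.
under eq_integral do rewrite EFinM.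
under [RHS]eq_integral do rewrite EFinM -muleA.
rewrite !ge0_integralZl//; first last.
- exact/measurable_EFinP.
- by move=> x _; rewrite mule_ge0 ?lee_fin.
- by apply: emeasurable_funM; apply/measurable_EFinP.
rewrite integral_indic// setIT nuE// integral_mkcond; congr (_ * _).
apply: eq_integral => x _; rewrite patchE indicE.
by case: ifPn => _; rewrite ?mul1e ?mul0e.
Qed.

(** It suffices to compare both sides on simple functions, where the identity is
    linearity plus the hypothesis on [nu]; the general case is then monotone
    convergence along the simple approximations of [f]. *)
Lemma integral_density (f : T -> \bar R) :
  measurable_fun setT f -> (forall x, 0 <= f x) ->
  \int[nu]_x f x = \int[mu]_x (f x * (g x)%:E).
Proof.
move=> mf f0; pose h := nnsfun_approx measurableT mf.
have hE x : f x = lim ((h n x)%:E @[n --> \oo]).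
  by apply/esym/cvg_lim => //; exact: cvg_nnsfun_approx.
have ndh x : nondecreasing_seq (fun n => (h n x)%:E).
  by move=> a b ab; rewrite lee_fin; exact/lefP/nd_nnsfun_approx.
have ndhg x : nondecreasing_seq (fun n => (h n x)%:E * (g x)%:E).
  by move=> a b ab; rewrite lee_wpmul2r ?lee_fin//; exact: ndh.
transitivity (\int[nu]_x lim ((h n x)%:E @[n --> \oo])).
  exact: eq_integral.
have mh n : measurable_fun setT (fun x => (h n x)%:E).
  exact/measurable_EFinP.
have mhg n : measurable_fun setT (fun x => (h n x)%:E * (g x)%:E).
  by apply: emeasurable_funM => //; exact/measurable_EFinP.
rewrite (monotone_convergence nu measurableT mh)//; last first.
  by move=> n x _; rewrite lee_fin.
transitivity (\int[mu]_x lim ((h n x)%:E * (g x)%:E @[n --> \oo])).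
  rewrite (monotone_convergence mu measurableT mhg)//; last first.
    by move=> n x _; rewrite mule_ge0 ?lee_fin.
  by congr (lim (_ @ \oo)); apply/funext => n; exact: integral_density_nnsfun.
apply: eq_integral => x _; apply/cvg_lim => //.
apply: cvgeZr => //.
  exact: cvg_nnsfun_approx.
Qed.
End density.

(** * Normal laws with scalar covariance *)

Definition sqdist {R : realType} n (x y : Rvec R n) : R :=
  \sum_(i < n) (tnth x i - tnth y i) ^+ 2.

Section gauss.
Context {R : realType} {n : nat}.
Implicit Types (m x y : Rvec R n) (s : R).

Lemma sqdist_ge0 x y : 0 <= sqdist x y.
Proof. by apply: sumr_ge0 => i _; exact: sqr_ge0. Qed.

Lemma sqdistC x y : sqdist x y = sqdist y x.
Proof. by apply: eq_bigr => i _; rewrite -sqrrN opprB. Qed.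

Lemma measurable_sqdist x : measurable_fun setT (sqdist x).
Proof.
apply: measurable_sum => i; apply: measurable_funX; apply: measurable_funB => //.
exact: measurable_tnth.
Qed.

Lemma mvnormal_pdf_sqdist m s y : 0 < s ->
  mvnormal_pdf m s%:M y =
  (Num.sqrt ((2 * pi * s) ^+ n))^-1 * expR (- sqdist y m / (2 * s)).
Proof.
move=> s0; rewrite /mvnormal_pdf det_scalar -exprMn; congr (_ * expR _).
rewrite invmx_scalar mul_mx_scalar -scalemxAl !mxE.
rewrite (eq_bigr (fun i => (tnth y i - tnth m i) ^+ 2)); last first.
  by move=> i _; rewrite !mxE expr2.
rewrite -/(sqdist y m); field; exact: lt0r_neq0.
Qed.

Lemma mvnormal_scalar_setT1 m s : 0 < s -> mvnormal m s%:M setT = 1%E.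
Proof.
by move=> s0; rewrite -(sqr_sqrtr (ltW s0)) mvnormal_scalar_setT// sqrtr_gt0.
Qed.

Lemma measurable_EFin_mvnormal_pdf m (S : 'M[R]_n) D :
  measurable_fun D (EFin \o mvnormal_pdf m S).
Proof.
by apply/measurable_EFinP/measurable_funTS; exact: measurable_mvnormal_pdf.
Qed.

(** On the ball, the density of N(m, I) is at most [(2 pi)^(-n/2)], which is at
    most [(s e^(1/2))^n] times the density of N(x, s^2 I).  The latter law has
    total mass one, which saves computing the volume of a ball. *)
Lemma mvnormal_small_ball m x (s : R) : 0 < s ->
  (mvnormal m 1%:M [set y | (sqdist x y <= n%:R * s ^+ 2)%R]
   <= ((s * expR (1 / 2)) ^+ n)%:E)%E.
Proof.
move=> s0; have s20 : 0 < s ^+ 2 by exact: exprn_gt0.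
set B := [set y | _]; set c := (_ ^+ n).
have mB : measurable B.
  have -> : B = sqdist x @^-1` [set t | t <= n%:R * s ^+ 2] by [].
  rewrite -[X in measurable X]setTI; apply: measurable_sqdist => //.
  by rewrite -set_itvNyc; exact: measurable_itv.
have c0 : 0 <= c by rewrite exprn_ge0// mulr_ge0 ?expR_ge0 ?ltW.
apply: (@le_trans _ _ (c%:E * mvnormal x (s ^+ 2)%:M B)%E); last first.
  rewrite -[leRHS]mule1 lee_wpmul2l ?lee_fin//.
  rewrite -[leRHS](mvnormal_scalar_setT1 x s20); apply: le_measure => //;
    by rewrite inE.
rewrite /mvnormal -ge0_integralZl_EFin//; first last.
- exact: measurable_EFin_mvnormal_pdf.
- by move=> y _; rewrite lee_fin mvnormal_pdf_ge0.
apply: ge0_le_integral => //.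
- by move=> y _; rewrite lee_fin mvnormal_pdf_ge0.
- exact: measurable_EFin_mvnormal_pdf.
- by apply: measurable_funeM; exact: measurable_EFin_mvnormal_pdf.
move=> y By; rewrite -EFinM lee_fin !mvnormal_pdf_sqdist// mulr1.
have -> : Num.sqrt ((2 * pi * s ^+ 2) ^+ n) =
    Num.sqrt ((2 * pi) ^+ n) * s ^+ n :> R.
  rewrite exprMn sqrtrM; last by rewrite exprn_ge0// mulr_ge0// pi_ge0.
  by rewrite -exprM mulnC exprM sqrtr_sqr ger0_norm// exprn_ge0// ltW.
have ringE (a u v e f : R) : u * e * (a * v * f) = a * ((u * v) * (e * f)).
  by ring.
have -> : c = s ^+ n * expR (1 / 2) ^+ n by exact: exprMn.
rewrite (invfM (Num.sqrt _)) ringE.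
rewrite ler_wpM2l ?invr_ge0 ?sqrtr_ge0// mulfV ?mul1r; last first.
  by rewrite expf_neq0// gt_eqF.
rewrite -expRM_natl -expRD ler_expR.
apply: (@le_trans _ _ 0).
  by rewrite mulNr oppr_le0 divr_ge0// sqdist_ge0.
have -> : n%:R / 2 + - sqdist y x / (2 * s ^+ 2) =
   (n%:R * s ^+ 2 - sqdist y x) / (2 * s ^+ 2).
  by field; exact: lt0r_neq0.
apply: divr_ge0; last by rewrite mulr_ge0// ltW.
by rewrite subr_ge0 sqdistC.
Qed.

Definition midpoint x y : Rvec R n := [tuple (tnth x i + tnth y i) / 2 | i < n].

(** By the parallelogram identity
    [|y - m1|^2 + |y - m2|^2 = 2 |y - (m1 + m2)/2|^2 + |m1 - m2|^2 / 2], the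
    geometric mean of two normal densities is again a normal density, up to the
    factor [exp(- |m1 - m2|^2 / (8 s))], their Bhattacharyya coefficient. *)
Lemma mvnormal_pdfM m1 m2 s y : 0 < s ->
  mvnormal_pdf m1 s%:M y * mvnormal_pdf m2 s%:M y =
  (expR (- sqdist m1 m2 / (8 * s)) * mvnormal_pdf (midpoint m1 m2) s%:M y) ^+ 2.
Proof.
move=> s0; rewrite !mvnormal_pdf_sqdist//; set S := (Num.sqrt _)^-1.
rewrite mulrACA -expRD.
rewrite exprMn -expRM_natl exprMn -expRM_natl mulrCA -expRD -expr2.
congr (_ * expR _).
have -> : sqdist y (midpoint m1 m2) =
    (sqdist y m1 + sqdist y m2) / 2 - sqdist m1 m2 / 4.
  rewrite /sqdist -big_split/= !mulr_suml -sumrB; apply: eq_bigr => i _.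
  by rewrite tnth_mktuple; field.
by field; exact: lt0r_neq0.
Qed.

(** Let [A] be the set where the second density is the smaller one.  Then
    [1 - ga = (1 - ga) (nu A + nu (~` A))] is at most the mass that the second
    law gives to [A] plus the mass that the first gives to [~` A], which is the
    integral of the minimum of the two densities.  The minimum is at most the
    geometric mean, and [mvnormal_pdfM] integrates the latter. *)
Lemma mvnormal_overlap m1 m2 s (ga : R) (nu : probability (Rvec R n) R) :
  0 < s ->
  (forall A, measurable A -> (1 - ga)%:E * nu A <= mvnormal m1 s%:M A)%E ->
  (forall A, measurable A -> (1 - ga)%:E * nu A <= mvnormal m2 s%:M A)%E ->
  1 - ga <= expR (- sqdist m1 m2 / (8 * s)).
Proof.
move=> s0 H1 H2; rewrite -lee_fin.
set k1 := mvnormal_pdf m1 s%:M; set k2 := mvnormal_pdf m2 s%:M.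
set c := expR _.
set k := mvnormal_pdf (midpoint m1 m2) s%:M.
pose A := [set y | k2 y <= k1 y].
have mA : measurable A.
  rewrite -[A]setTI; apply: measurable_fun_le => //;
  exact: measurable_mvnormal_pdf.
have mAC : measurable (~` A) by exact: measurableC.
have le_sqrt (u v w : R) : 0 <= u -> 0 <= w -> u <= v -> u * v = w ^+ 2 ->
    u <= w.
  move=> u0 w0 uv e; rewrite -(@ler_pXn2r _ 2)// -e expr2.
  exact: ler_wpM2l.
have kk y : k1 y * k2 y = (c * k y) ^+ 2 by exact: mvnormal_pdfM.
have ck0 y : 0 <= c * k y by rewrite mulr_ge0 ?expR_ge0 ?mvnormal_pdf_ge0.
have bound m E : measurable E ->
    (forall y, E y -> mvnormal_pdf m s%:M y <= c * k y) ->
    (mvnormal m s%:M E <= c%:E * mvnormal (midpoint m1 m2) s%:M E)%E.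
  move=> mE le_k; rewrite /mvnormal -ge0_integralZl_EFin//; first last.
  - exact: expR_ge0.
  - exact: measurable_EFin_mvnormal_pdf.
  - by move=> y _; rewrite lee_fin mvnormal_pdf_ge0.
  apply: ge0_le_integral => //.
  - by move=> y _; rewrite lee_fin mvnormal_pdf_ge0.
  - exact: measurable_EFin_mvnormal_pdf.
  - by apply: measurable_funeM; exact: measurable_EFin_mvnormal_pdf.
have b2 : (mvnormal m2 s%:M A <= c%:E * mvnormal (midpoint m1 m2) s%:M A)%E.
  apply: bound => // y Ay; apply: le_sqrt Ay _; rewrite ?mvnormal_pdf_ge0//.
  by rewrite mulrC.
have b1 : (mvnormal m1 s%:M (~` A) <=
           c%:E * mvnormal (midpoint m1 m2) s%:M (~` A))%E.
  apply: bound => //.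
  move=> y /negP; rewrite -ltNge => /ltW Ay.
  by apply: le_sqrt Ay _; rewrite ?mvnormal_pdf_ge0.
have nuT : (nu A + nu (~` A) = 1)%E.
  by rewrite -measureU ?setUv ?setICr//; exact: probability_setT.
have midT : (mvnormal (midpoint m1 m2) s%:M A +
             mvnormal (midpoint m1 m2) s%:M (~` A) = 1)%E.
  by rewrite -measureU ?setUv ?setICr//; exact: mvnormal_scalar_setT1.
rewrite -[leLHS]mule1 -nuT muleDr ?ge0_adde_def ?inE//.
apply: (le_trans (leeD (H2 _ mA) (H1 _ mAC))).
apply: (le_trans (leeD b2 b1)).
by rewrite -ge0_muleDr// midT mule1.
Qed.

End gauss.

(** * The stationary mass of the sublevel sets of a drift function *)

Section drift.
Context d (T : measurableType d) (R : realType).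
Variables (K : R.-pker T ~> T) (V : T -> R) (lambda L : R).
Hypotheses (mV : measurable_fun setT V) (V0 : forall x, 0 <= V x).
Hypotheses (lambda1 : lambda < 1) (drift : drift_condition K V lambda L).

(** Let [m >= 0] be the infimum of [V].  When [lambda > 0], averaging [V >= m]
    under [K x] and letting [V x] approach [m] gives [m <= lambda * m + L]; when
    [lambda <= 0], already [0 <= lambda * V x + L] suffices. *)
Lemma drift_const_ge0 : T -> 0 <= L.
Proof.
move=> x0.
have lb m x : 0 <= m -> (forall y, m <= V y) -> m <= lambda * V x + L.
  move=> m0 mle; rewrite -lee_fin; apply: le_trans (drift x).
  have <- : (\int[K x]_y m%:E = m%:E)%E.
    by rewrite integral_cst//= prob_kernel mule1.
  apply: ge0_le_integral => //; first exact/measurable_EFinP.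
  by move=> y _; rewrite lee_fin.
have [l0|l0] := leP lambda 0.
  have := lb 0 x0 (lexx _) V0; have := mulr_le0_ge0 l0 (V0 x0); lra.
pose m := inf (range V).
have Vlb : has_lbound (range V) by exists 0 => _ [y _ <-].
have m0 : 0 <= m by apply: lb_le_inf; [exists (V x0); exists x0|move=> _ [y _ <-]].
have mle y : m <= V y by apply: ge_inf => //; exists y.
have : (m - L) / lambda <= m.
  apply: lb_le_inf; first by exists (V x0); exists x0.
  by move=> _ [y _ <-]; rewrite ler_pdivrMr// lerBlDr mulrC; exact: lb.
rewrite ler_pdivrMr//.
have : 0 <= m * (1 - lambda) by rewrite mulr_ge0// subr_ge0 ltW.
lra.
Qed.

Variable mu : {measure set T -> \bar R}.
Hypothesis mu1 : mu setT = 1%E.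
Hypothesis invariant : forall f : T -> \bar R,
  measurable_fun setT f -> (forall x, 0 <= f x)%E ->
  (\int[mu]_x \int[K x]_y f y = \int[mu]_x f x)%E.

Let mVle (c : R) : measurable [set x | V x <= c].
Proof. by rewrite -[X in measurable X]setTI; exact: measurable_fun_le. Qed.

Let mVlt (c : R) : measurable [set x | c < V x].
Proof.
rewrite (_ : [set x | _] = ~` [set x | V x <= c]); first exact: measurableC.
by apply/seteqP; split => x /=; rewrite ltNge => /negP.
Qed.

(** With [f] the minimum of [V] and [n], the drift bounds [K f] by
    [lambda * V + L] where [V <= n], and trivially by [n] elsewhere.
    Stationarity turns this into an inequality between two finite integrals, in
    which the region [V > n] contributes [n] to both sides and cancels; this is
    what makes truncation lossless.  On [V <= n] what remains is
    [(1 - lambda) V <= L] on average. *)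
Lemma stationary_truncated_tail d0 (n : R) : T -> 0 <= d0 -> 0 <= n ->
  (((1 - lambda) * d0)%:E * mu [set x | (d0 < V x <= n)%R] <= L%:E)%E.
Proof.
move=> x0 d0_ge0 n0; have L0 := drift_const_ge0 x0.
set A := [set x | _]; set B := [set x | V x <= n].
have mA : measurable A.
  have -> : A = [set x | d0 < V x] `&` B.
    by apply/seteqP; split => [x /= /andP[]|x /= [? ?]]//; apply/andP.
  exact: measurableI (mVlt _) (mVle _).
have al0 : 0 <= (1 - lambda) * d0 by rewrite mulr_ge0// subr_ge0 ltW.
have mB : measurable B by exact: mVle.
set al := _ * d0 in al0 *.
pose f x := Num.min (V x) n.
pose h x := if V x <= n then lambda * V x + L else n.
have f0 x : 0 <= f x by rewrite le_min V0.
have mf : measurable_fun setT f by exact: measurable_minr.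
have h0 x : 0 <= h x.
  rewrite /h; case: ifP => // _; rewrite -lee_fin.
  by apply: le_trans (drift x); apply: integral_ge0 => y _; rewrite lee_fin.
have mh : measurable_fun setT h.
  apply: measurable_fun_ifT => //.
  - exact: measurable_fun_ler.
  - by apply: measurable_funD => //; exact: measurable_funM.
have Kf x : (\int[K x]_y (f y)%:E <= (h x)%:E)%E.
  rewrite /h; case: ifP => Vn.
    apply: le_trans (drift x); apply: ge0_le_integral => //.
    - by move=> y _; rewrite lee_fin.
    - exact/measurable_EFinP.
    - exact/measurable_EFinP.
    - by move=> y _; rewrite lee_fin ge_min lexx.
  have <- : (\int[K x]_y n%:E = n%:E)%E.
    by rewrite integral_cst//= prob_kernel mule1.
  apply: ge0_le_integral => //.
  - by move=> y _; rewrite lee_fin.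
  - exact/measurable_EFinP.
  - by move=> y _; rewrite lee_fin ge_min lexx orbT.
have muS E : measurable E -> (mu E <= 1)%E.
  by move=> mE; rewrite -mu1 le_measure ?inE.
have intf : (\int[mu]_x (f x)%:E <= \int[mu]_x (h x)%:E)%E.
  rewrite -(@invariant (EFin \o f))//; last exact/measurable_EFinP.
  apply: ge0_le_integral => //.
  - by move=> x _; apply: integral_ge0 => y _; rewrite lee_fin.
  - apply: measurable_fun_integral_kernel => //.
    + by move=> U mU; exact: measurable_kernel.
    + exact/measurable_EFinP.
  - exact/measurable_EFinP.
have fin_f : (\int[mu]_x (f x)%:E)%E \is a fin_num.
  rewrite ge0_fin_numE; last by apply: integral_ge0 => x _; rewrite lee_fin.
  apply: (@le_lt_trans _ _ (\int[mu]_x n%:E)%E); last first.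
    by rewrite integral_cst//= mu1 mule1 ltry.
  apply: ge0_le_integral => //.
  - by move=> y _; rewrite lee_fin.
  - exact/measurable_EFinP.
  - by move=> y _; rewrite lee_fin ge_min lexx orbT.
have intZ (c : R) E : 0 <= c -> measurable E ->
    (\int[mu]_x (c * \1_E x)%:E = c%:E * mu E)%E.
  move=> c0 mE; under eq_integral do rewrite EFinM.
  rewrite ge0_integralZl//; first by rewrite integral_indic// setIT.
  exact/measurable_EFinP/measurable_indic.
have mZ (c : R) (E : set T) : measurable E ->
    measurable_fun setT (fun x : T => (c * \1_E x)%:E).
  by move=> mE; apply/measurable_EFinP; exact: measurable_funM.
(* Both sides are arranged as sums of nonnegative functions, so that they can
   be integrated termwise and the integral of [f] cancelled.  The constant
   [al] bounds [(1 - lambda) * V] from below on [A]. *)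
have : (\int[mu]_x ((h x)%:E + (al * \1_A x)%:E) <=
        \int[mu]_x ((f x)%:E + (L * \1_B x)%:E))%E.
  apply: ge0_le_integral => //.
  - by move=> x _; rewrite -EFinD lee_fin addr_ge0// mulr_ge0.
  - by apply: emeasurable_funD; [exact/measurable_EFinP|exact: mZ].
  - by apply: emeasurable_funD; [exact/measurable_EFinP|exact: mZ].
  move=> x _; rewrite -!EFinD lee_fin /h /f !indicE.
  have [Vn|nV] := leP (V x) n; last first.
    rewrite !memNset ?mulr0//=; first by apply/negP; rewrite -ltNge.
    by apply/negP; rewrite negb_and -!ltNge nV orbT.
  rewrite (mem_set (Vn : B x)) mulr1.
  have Vl : lambda * V x <= V x by rewrite ler_piMl// ltW.
  have [dV|Vd] := ltP d0 (V x).
    rewrite mem_set ?mulr1; last by apply/andP.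
    have : (1 - lambda) * d0 <= (1 - lambda) * V x.
      by rewrite ler_wpM2l ?subr_ge0// ltW.
    rewrite /al; lra.
  rewrite memNset ?mulr0 ?addr0 ?lerD2r//.
  by apply/negP; rewrite negb_and -leNgt Vd.
rewrite !ge0_integralD//; last 8 first.
- by move=> x _; rewrite lee_fin.
- exact/measurable_EFinP.
- by move=> x _; rewrite lee_fin mulr_ge0.
- exact: mZ.
- by move=> x _; rewrite lee_fin.
- exact/measurable_EFinP.
- by move=> x _; rewrite lee_fin mulr_ge0.
- exact: mZ.
rewrite !intZ// => le1.
have : (\int[mu]_x (f x)%:E + al%:E * mu A <=
        \int[mu]_x (f x)%:E + L%:E * mu B)%E.
  by apply: le_trans le1; rewrite leeD2r.
rewrite leeD2lE// => /le_trans; apply.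
by rewrite -[leRHS]mule1 lee_wpmul2l ?lee_fin// muS.
Qed.

(** The truncated bounds do not depend on the truncation level, hence pass to
    the limit: [mu (V > d0) <= L / ((1 - lambda) d0)]. *)
Lemma stationary_tail d0 : T -> 2 * L / (1 - lambda) < d0 ->
  (mu [set x | (d0 < V x)%R] < (1 / 2)%:E)%E.
Proof.
move=> x0 Ld0; have L0 := drift_const_ge0 x0.
have l1 : 0 < 1 - lambda by rewrite subr_gt0.
have d0_gt0 : 0 < d0.
  by apply: le_lt_trans Ld0; rewrite divr_ge0 ?mulr_ge0// ltW.
pose F n := [set x | (d0 < V x <= n%:R)%R].
have mF n : measurable (F n).
  have -> : F n = [set x | d0 < V x] `&` [set x | V x <= n%:R].
    by apply/seteqP; split => [x /= /andP[]|x /= [? ?]]//; apply/andP.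
  exact: measurableI (mVlt _) (mVle _).
have FE : \bigcup_n F n = [set x | d0 < V x].
  apply/seteqP; split => [x [n _ /andP[]]//|x /= dV].
  exists (Num.trunc (V x)).+1 => //=; apply/andP; split => //.
  by rewrite ltW// truncnS_gt.
have ndF : {homo F : n m / (n <= m)%N >-> (n <= m)%O}.
  move=> n m nm; apply/subsetPset => x /= /andP[dV Vn].
  by apply/andP; split => //; rewrite (le_trans Vn)// ler_nat.
have al0 : 0 < (1 - lambda) * d0 by exact: mulr_gt0.
have Fle n : (mu (F n) <= (L / ((1 - lambda) * d0))%:E)%E.
  have := stationary_truncated_tail x0 (ltW d0_gt0) (ler0n R n).
  by rewrite muleC -lee_pdivlMr// muleC -EFinM mulrC.
have mU : measurable (\bigcup_n F n) by exact: bigcup_measurable.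
have cv := @nondecreasing_cvg_mu _ _ _ mu _ mF mU ndF.
rewrite -FE -(cvg_lim _ cv)//.
apply: (@le_lt_trans _ _ (L / ((1 - lambda) * d0))%:E).
  apply: lime_le; first by apply/cvg_ex; eexists; exact: cv.
  exact: nearW.
rewrite lte_fin ltr_pdivrMr//; move: Ld0; rewrite ltr_pdivrMr//; lra.
Qed.

End drift.

(** * The Gaussian kernel and its stationary law *)

Definition origin {R : realType} {n} : Rvec R n := [tuple 0 | i < n].

Lemma integral_mvnormal (R : realType) n m (S : 'M[R]_n) (f : Rvec R n -> \bar R) :
  measurable_fun setT f -> (forall x, 0 <= f x)%E ->
  (\int[mvnormal m S]_x f x =
   \int[lebesgue_tuple n]_x (f x * (mvnormal_pdf m S x)%:E))%E.
Proof.
move=> mf f0.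
apply: (@integral_density _ _ _ (lebesgue_tuple n) (mvnormal m S)) => //.
  exact: measurable_mvnormal_pdf.
exact: mvnormal_pdf_ge0.
Qed.

(** The exponents on the two sides are
    [- (2/3) (|x|^2 + |y|^2 - <x, y>)], which is symmetric. *)
Lemma gauss_reversible (R : realType) n (x y : Rvec R n) :
  mvnormal_pdf (@origin R n) 1%:M x *
    mvnormal_pdf [tuple tnth x i / 2 | i < n] (3 / 4)%:M y =
  mvnormal_pdf origin 1%:M y *
    mvnormal_pdf [tuple tnth y i / 2 | i < n] (3 / 4)%:M x.
Proof.
have s0 : 0 < 3 / 4 :> R by lra.
rewrite !mvnormal_pdf_sqdist// !(mulrACA _ (expR _)) -!expRD.
congr (_ * expR _).
have E (u v : Rvec R n) : - sqdist u origin / (2 * 1) +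
    - sqdist v [tuple tnth u i / 2 | i < n] / (2 * (3 / 4)) =
    \sum_(i < n) - (2 / 3) *
      (tnth u i ^+ 2 + tnth v i ^+ 2 - tnth u i * tnth v i).
  rewrite !mulNr !mulr_suml -!sumrN -big_split; apply: eq_bigr => i _ /=.
  by rewrite !tnth_mktuple; field.
by rewrite !E; apply: eq_bigr => i _; ring.
Qed.

(** Reversibility lets one write the left-hand side as the double integral of
    [f y * pi(y) * k(y, x)]; integrating in [x] first leaves [f y * pi(y)]. *)
Lemma gauss_invariant (R : realType) n (f : Rvec R n -> \bar R) :
  measurable_fun setT f -> (forall x, 0 <= f x)%E ->
  (\int[mvnormal (@origin R n) 1%:M]_x \int[gauss_kernel x]_y f y =
   \int[mvnormal (@origin R n) 1%:M]_x f x)%E.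
Proof.
move=> mf f0.
pose k (x y : Rvec R n) :=
  mvnormal_pdf [tuple tnth x i / 2 | i < n] (3 / 4)%:M y.
pose p0 : Rvec R n -> R := mvnormal_pdf origin 1%:M.
have k0 x y : 0 <= k x y by exact: mvnormal_pdf_ge0.
have p00 x : 0 <= p0 x by exact: mvnormal_pdf_ge0.
have mp0 : measurable_fun setT p0 by exact: measurable_mvnormal_pdf.
have mk x : measurable_fun setT (k x) by exact: measurable_mvnormal_pdf.
have mKf : measurable_fun setT (fun x => \int[gauss_kernel x]_y f y)%E.
  apply: measurable_fun_integral_kernel => // U mU; exact: measurable_kernel.
have Kf0 x : (0 <= \int[gauss_kernel x]_y f y)%E by exact: integral_ge0.
rewrite integral_mvnormal// [RHS]integral_mvnormal//.
pose F (z : Rvec R n * Rvec R n) : \bar R :=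
  (f z.2 * ((p0 z.2)%:E * (k z.2 z.1)%:E))%E.
have mF : measurable_fun setT F.
  apply: emeasurable_funM; first exact: measurableT_comp.
  apply: emeasurable_funM; apply/measurable_EFinP; first exact: measurableT_comp.
  pose h (x : Rvec R n) : Rvec R n := [tuple tnth x i / 2 | i < n].
  have mh : measurable_fun setT h.
    apply/measurable_fun_tnthP => i.
    under [X in measurable_fun _ X]eq_fun do rewrite /= tnth_mktuple.
    by apply: measurable_funM => //; exact: measurable_tnth.
  pose g (z : Rvec R n * Rvec R n) := (h z.2, z.1).
  have mg : measurable_fun setT g.
    by apply: measurable_fun_pair => //; exact: measurableT_comp.
  exact: (measurableT_comp (measurable_mvnormal_pdf2 (3 / 4)%:M) mg).
have F0 z : (0 <= F z)%E by rewrite /F !mule_ge0 ?lee_fin.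
transitivity (\int[lebesgue_tuple n]_x \int[lebesgue_tuple n]_y F (x, y))%E.
  apply: eq_integral => x _.
  have -> : (\int[gauss_kernel x]_y f y =
      \int[lebesgue_tuple n]_y (f y * (k x y)%:E))%E.
    exact: integral_mvnormal.
  rewrite -ge0_integralZr ?lee_fin//; first last.
  - by move=> y _; rewrite mule_ge0 ?lee_fin.
  - by apply: emeasurable_funM => //; exact/measurable_EFinP.
  apply: eq_integral => y _; rewrite /F/= -muleA -!EFinM; congr (_ * _%:E)%E.
  by rewrite mulrC gauss_reversible.
rewrite fubini_tonelli//; apply: eq_integral => y _; rewrite /F/=.
have kT : (\int[lebesgue_tuple n]_x (k y x)%:E = 1)%E.
  exact: (@prob_kernel _ _ _ _ _ (@gauss_kernel R n) y).
under eq_integral do rewrite muleA.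
rewrite ge0_integralZl ?kT ?mule1//.
- exact/measurable_EFinP.
- by move=> x _; rewrite lee_fin.
- by rewrite mule_ge0 ?lee_fin.
Qed.

(** Otherwise the sublevel set would lie in a ball of squared radius [n / 16]
    around one of its points.  This ball and the tail [V > d] each have
    stationary mass less than 1/2, and together they would cover the space. *)
Lemma sublevel_spread (R : realType) n (K := @gauss_kernel R n)
    (V : Rvec R n -> R) (lambda L d : R) :
  (0 < n)%N -> measurable_fun setT V -> (forall x, 0 <= V x) -> lambda < 1 ->
  drift_condition K V lambda L -> 2 * L / (1 - lambda) < d ->
  exists x y, [/\ V x <= d, V y <= d & n%:R / 16 < sqdist x y].
Proof.
move=> n0 mV V0 l1 dr Ld; pose mu := mvnormal (@origin R n) 1%:M.
have muT : mu setT = 1%E by exact: mvnormal_scalar_setT1.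
have tail : (mu [set x | (d < V x)%R] < (1 / 2)%:E)%E.
  exact: (@stationary_tail _ _ _ _ _ _ _ mV V0 l1 dr
    (mvnormal (@origin R n) 1%:M) muT (@gauss_invariant R n) _ origin Ld).
have mtail : measurable [set x | d < V x].
  rewrite (_ : [set x | _] = ~` [set x | V x <= d]).
    by apply: measurableC; rewrite -[X in measurable X]setTI;
      exact: measurable_fun_le.
  by apply/seteqP; split => x /=; rewrite ltNge => /negP.
apply: contrapT => noxy.
have close x y : V x <= d -> V y <= d -> sqdist x y <= n%:R / 16.
  move=> xd yd; rewrite leNgt; apply/negP => far; apply: noxy.
  by exists x, y.
have [x xd] : exists x, V x <= d.
  apply: contrapT => nox; move: tail.
  rewrite (_ : [set x | _] = setT) ?muT ?lte_fin; first lra.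
  apply/seteqP; split => // x _ /=; rewrite ltNge; apply/negP => xd.
  by apply: nox; exists x.
(* Radius [s * sqrt n] with [s = 1/4], for which [s * e^(1/2) < 1/2]. *)
have ball : (mu [set y | (sqdist x y <= n%:R * (1 / 4) ^+ 2)%R] < (1 / 2)%:E)%E.
  apply: le_lt_trans (mvnormal_small_ball _ _ _) _ => //; rewrite lte_fin.
  have e2 : expR (1 / 2) < 2 :> R.
    (* [expR (- (1 / 2)) > 1 - 1 / 2] *)
    rewrite -[ltLHS]invrK -expRN invf_plt ?posrE ?expR_gt0//.
    have hN0 : - (1 / 2) != 0 :> R by rewrite lt_eqF//; lra.
    by apply: le_lt_trans (expR_gt1Dx hN0); lra.
  apply: (@le_lt_trans _ _ (1 / 4 * expR (1 / 2))); last lra.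
  have e0 : 0 <= 1 / 4 * expR (1 / 2) :> R by rewrite mulr_ge0 ?expR_ge0.
  rewrite -[leRHS]expr1; apply: ler_wiXn2l => //; lra.
have mball : measurable [set y | (sqdist x y <= n%:R * (1 / 4) ^+ 2)].
  by rewrite -[X in measurable X]setTI; apply: measurable_fun_le => //;
    exact: measurable_sqdist.
have : (mu setT < 1)%E; last by rewrite muT ltxx.
apply: (@le_lt_trans _ _ (mu ([set y | (d < V y)%R] `|`
    [set y | (sqdist x y <= n%:R * (1 / 4) ^+ 2)%R]))).
  apply: le_measure; rewrite ?inE//; first exact: measurableU.
  move=> y _ /=; have [dV|Vd] := ltP d (V y); [by left|right].
  by apply: le_trans (close _ _ xd Vd) _; lra.
apply: (le_lt_trans (measureU2 _ mtail mball)).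
rewrite (_ : 1%E = (1 / 2)%:E + (1 / 2)%:E)%E; last first.
  by rewrite -EFinD; congr EFin; field.
exact: lteD.
Qed.

(** * The rate of convergence of the bound *)

Theorem proposition4 (R : realType)
    (V : forall p : nat, Rvec R p -> R)
    (lambda L d gamma a : nat -> R)
    (nu : forall p : nat, probability (Rvec R p) R)
    (mV : forall p : nat, (1 <= p)%N -> measurable_fun [set: Rvec R p] (V p))
    (V_ge0 : forall p : nat, (1 <= p)%N -> forall x : Rvec R p, 0 <= V p x)
    (lambda_lt1 : forall p : nat, (1 <= p)%N -> lambda p < 1)
    (d_gt : forall p : nat, (1 <= p)%N -> 2 * L p / (1 - lambda p) < d p)
    (gamma_lt1 : forall p : nat, (1 <= p)%N -> gamma p < 1)
    (drift : forall p : nat, (1 <= p)%N ->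
      drift_condition (@gauss_kernel R p) (V p) (lambda p) (L p))
    (minorization : forall p : nat, (1 <= p)%N ->
      minorization_condition (@gauss_kernel R p)
        [set x : Rvec R p | V p x <= d p] (gamma p) (nu p))
    (a01 : forall p : nat, (1 <= p)%N -> 0 < a p < 1)
    (rho_defined : forall p : nat, (1 <= p)%N ->
      rosenthal_rho_defined (lambda p) (L p) (d p) (gamma p))
    (rho_lt1 : forall p : nat, (1 <= p)%N ->
      rosenthal_rho (lambda p) (L p) (d p) (gamma p) (a p) < 1) :
  exists c r : R, 0 < r < 1 /\
    forall p : nat, (1 <= p)%N ->
      0 < 1 - rosenthal_rho (lambda p) (L p) (d p) (gamma p) (a p)
        <= c * r ^+ p.
Proof.
(* 384 = 24 * 16: overlap exp(- |x - y|^2 / 24) with |x - y|^2 > p / 16. *)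
exists 1, (expR (- (384^-1))); split.
  by rewrite expR_gt0 expR_lt1 oppr_lt0 invr_gt0 ltr0n.
move=> p p1; apply/andP; split; first by rewrite subr_gt0; exact: rho_lt1.
have [g0 _ _] := rho_defined _ p1; have /andP[a0 a1] := a01 _ p1.
have g_le_rho :
    gamma p <= rosenthal_rho (lambda p) (L p) (d p) (gamma p) (a p).
  rewrite le_max; apply/orP; left.
  move: g0; rewrite le_eqVlt => /predU1P[<-|g0]; first exact: powR_ge0.
  by apply: ger1_powR; rewrite ?g0 ltW//= gamma_lt1.
apply: (@le_trans _ _ (1 - gamma p)); first by rewrite lerD2l lerN2.
have [x [y [xd yd far]]] := sublevel_spread p1 (mV _ p1) (V_ge0 _ p1)
  (lambda_lt1 _ p1) (drift _ p1) (d_gt _ p1).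
have s0 : 0 < 3 / 4 :> R by lra.
have := mvnormal_overlap s0 (minorization _ p1 x xd) (minorization _ p1 y yd).
move/le_trans; apply; rewrite mul1r -expRM_natl ler_expR.
have -> : sqdist [tuple tnth x i / 2 | i < p] [tuple tnth y i / 2 | i < p] =
    sqdist x y / 4.
  rewrite /sqdist mulr_suml; apply: eq_bigr => i _.
  by rewrite !tnth_mktuple; field.
lra.
Qed.
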